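(* Let $A$ be a ring which is contained (as a subring) in a $\mathbb{Q}$-algebra $Q$. Let $R:=A[T]/(T^2)$ and $t:=T+(T^2)\in R$. Then for any $\varphi_1\in\mathrm{EA}_2(R)$ there exist a $\varphi_0\in\mathrm{EA}_2(A)$ and an $H\in Q[X,Y]$ with $\frac{\partial H}{\partial X},\frac{\partial H}{\partial Y}\in A[X,Y]$ such that $$\varphi_1=\varphi_0\circ\left(X+t\frac{\partial H}{\partial Y},\,Y-t\frac{\partial H}{\partial X}\right).$$ Moreover, $H$ is of the form $$H=\frac{a_1}{m_1}f_1^{m_1}+\cdots+\frac{a_r}{m_r}f_r^{m_r},$$ where $a_i\in A$, each $m_i$ is a positive integer, and each $f_i$ is a coordinate of an automorphism in $\mathrm{EA}_2(A)$.
   Context: All rings are commutative with identity. For a ring $R$, a polynomial map over $R$ is an ordered pair $(F,G)$ of polynomials in $R[X,Y]$; $F$ and $G$ are called its coordinates. Composition is $(F_1,G_1)\circ(F_2,G_2)=(F_1(F_2,G_2),G_1(F_2,G_2))$, and the identity is $(X,Y)$. $\mathrm{GA}_2(R)$ is the group (under composition) of invertible polynomial maps, called automorphisms. $\mathrm{EA}_2(R)$ is the subgroup of $\mathrm{GA}_2(R)$ generated by the elementary automorphisms, i.e. those of the form $(X+f(Y),Y)$ or $(X,Y+f(X))$ with $f$ a univariate polynomial over $R$. Since $A\subseteq R=A\oplus At$, the group $\mathrm{EA}_2(A)$ is viewed as a subgroup of $\mathrm{EA}_2(R)$. *)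

(* Defs.v *)
From HB Require Import structures.
From mathcomp Require Import all_boot all_order all_algebra.
From mathcomp Require Export mpoly.

Set Implicit Arguments.
Unset Strict Implicit.
Unset Printing Implicit Defensive.

Import GRing.Theory.
Local Open Scope ring_scope.

(* R[X,Y] is {mpoly R[2]}, with X = 'X_0 and Y = 'X_1. *)
Definition polymap (R : comNzRingType) : Type := {mpoly R[2]} * {mpoly R[2]}.

Section PolyMaps.
Variable R : comNzRingType.
Implicit Types phi psi : polymap R.

Definition pm_id : polymap R := ('X_0, 'X_1).

Definition pm_comp phi psi : polymap R :=
  (phi.1 \mPo [tuple psi.1; psi.2], phi.2 \mPo [tuple psi.1; psi.2]).

Definition pm_inverse phi psi : Prop :=
  pm_comp phi psi = pm_id /\ pm_comp psi phi = pm_id.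

Definition GA2 phi : Prop := exists psi, pm_inverse phi psi.

Definition subst_var (f : {poly R}) (i : 'I_2) : {mpoly R[2]} :=
  (map_poly (@mpolyC 2 R) f).['X_i].

Definition elementary phi : Prop :=
  exists f : {poly R},
    phi = ('X_0 + subst_var f 1, 'X_1) \/ phi = ('X_0, 'X_1 + subst_var f 0).

Definition GA2_subgroup (S : polymap R -> Prop) : Prop :=
  [/\ forall phi, S phi -> GA2 phi,
      S pm_id,
      forall phi psi, S phi -> S psi -> S (pm_comp phi psi)
    & forall phi psi, S phi -> pm_inverse phi psi -> S psi].

Definition EA2 phi : Prop :=
  forall S : polymap R -> Prop,
    GA2_subgroup S -> (forall psi, elementary psi -> S psi) -> S phi.

Definition EA2_coordinate (f : {mpoly R[2]}) : Prop :=
  exists phi, EA2 phi /\ (f = phi.1 \/ f = phi.2).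

End PolyMaps.

Definition pm_map (R S : comNzRingType) (h : R -> S) (phi : polymap R)
  : polymap S := (map_mpoly h phi.1, map_mpoly h phi.2).

(* 'X^2 is monic of size > 1, so {poly %/ 'X^2} is the genuine quotient by 'X^2
   rather than the default value of the construction (mk_monic_Xn). *)
Definition dual (A : comNzRingType) : comNzRingType :=
  {poly %/ ('X^2 : {poly A})}.

Definition dual_t (A : comNzRingType) : dual A := 'qX.

Definition dualC (A : comNzRingType) : A -> dual A := @qpolyC A 'X^2.

(* Main.v *)
Require Import Defs.
From HB Require Import structures.
From mathcomp Require Import all_boot all_order all_algebra.
From mathcomp Require Import mpoly.
From mathcomp Require Import ring.

Set Implicit Arguments.
Unset Strict Implicit.
Unset Printing Implicit Defensive.

Import GRing.Theory.
Local Open Scope ring_scope.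

(** Modulo [t ^ 2 = 0], a map congruent to the identity mod [t] is an
infinitesimal vector field, and the maps [(X + t H_Y, Y - t H_X)] are the
infinitesimal Hamiltonian flows.  Call such a map [e(H)].  Three facts make
the theorem formal.

- Flows add: [e(H) o e(K) = e(H + K)], by first-order Taylor expansion
  ([infinitesimal_comp]).

- Over [A], an element [psi] of [EA2] has Jacobian determinant 1
  ([jacobian_EA2]), that is, it is symplectic, and a symplectic change of
  variables carries the flow of [H] to the flow of [H o psi]:
  [e(H) o psi = psi o e(H o psi)] ([infinitesimal_conj]).

- An elementary map over [A + A t] is, say, [(X + g0(Y) + t g1(Y), Y)]; it is
  the elementary map of [g0] followed by the flow of a primitive of [g1], and
  a primitive of [g1(Y)] is a sum of terms [a / m * Y ^ m].  The other kind is
  the same up to a sign ([elementary_decomposition]).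

By the first two, the products [phi0 o e(H)] with [phi0] in [EA2(A)] are
closed under composition and inverse.  The shape of [H] is kept as well: a sum
of powers of coordinates composed with [psi] in [EA2(A)] is again one, since
[f o psi] is a coordinate whenever [f] is.  So these products form a group
containing the elementary maps, hence all of [EA2(A + A t)]
([decomposition_subgroup]).

Only the two partial derivatives of [H] enter the flow, and these have
coefficients in [A].  Hence the flow is indexed below by a pair [U, V] of
polynomials over [A] (the vector field is [V d/dX - U d/dY]), while [H] itself,
which needs denominators, is carried alongside over [Q] by the predicate
[hamiltonian].

The ring of dual numbers enters only through a morphism [h] from [A], an
element [t] of square zero and a splitting [x = h (re x) + t * h (im x)]. *)

(** * Polynomials in several variables *)

Section PolynomialRing.
Variables (n : nat) (R : comNzRingType).

(** Both sides of every substitution identity below are determined by their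
behaviour on sums and products, so this induction reduces such an identity to
constants and variables. *)
Lemma mpoly_ringind (P : {mpoly R[n]} -> Prop) :
  (forall c, P c%:MP) -> (forall i, P 'X_i) ->
  (forall p q, P p -> P q -> P (p + q)) ->
  (forall p q, P p -> P q -> P (p * q)) ->
  forall p, P p.
Proof.
move=> PC PX PD PM; elim/mpolyind => [|c m p _ _ Pp]; first by rewrite -mpolyC0.
have P1 : P 1 by rewrite -mpolyC1.
have PXn i k : P ('X_i ^+ k) by elim: k => [|k IHk] //; rewrite exprS; apply/PM.
rewrite -mul_mpolyC mpolyXE_id; apply/PD => //; apply/PM => //.
by apply: (big_ind P).
Qed.

Lemma mderivXU (i j : 'I_n) : 'X_j^`M(i) = (j == i)%:R :> {mpoly R[n]}.
Proof.
rewrite mderivX mnm1E; case: eqP => [->|_]; last by rewrite scale0r.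
suff -> : (U_(i) - U_(i) = 0)%MM by rewrite mpolyX0 scale1r.
by apply/mnmP => k; rewrite mnmBE mnm0E subnn.
Qed.

Lemma mderiv_exp (p : {mpoly R[n]}) k i :
  (p ^+ k)^`M(i) = (p ^+ k.-1 * p^`M(i)) *+ k.
Proof.
elim: k => [|k IHk]; first by rewrite mulr0n expr0 -mpolyC1 mderivC.
rewrite exprS mderivM IHk mulrnAr mulrA mulrS [_ * p ^+ k]mulrC.
by case: k {IHk} => [|k]; rewrite ?mulr0n // -exprS.
Qed.

End PolynomialRing.

(** * Substitution, composition and the Jacobian determinant *)

Section Substitution.
Variable R : comNzRingType.
Implicit Types (phi psi rho : polymap R) (p q : {mpoly R[2]}).

(** Naming the action [p |-> p o phi] exposes the ring morphism behind each
coordinate of [pm_comp]. *)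
Definition pm_subst phi : {mpoly R[2]} -> {mpoly R[2]} :=
  comp_mpoly [tuple phi.1; phi.2].

HB.instance Definition _ phi :=
  GRing.RMorphism.copy (pm_subst phi) (comp_mpoly [tuple phi.1; phi.2]).

Lemma pm_compE phi psi :
  pm_comp phi psi = (pm_subst psi phi.1, pm_subst psi phi.2).
Proof. by []. Qed.

Lemma pm_substC phi c : pm_subst phi c%:MP = c%:MP.
Proof. exact: comp_mpolyC. Qed.

Lemma pm_substZ phi c p : pm_subst phi (c *: p) = c *: pm_subst phi p.
Proof. exact: comp_mpolyZ. Qed.

Lemma pm_substX phi i :
  pm_subst phi 'X_i = if i == 0 then phi.1 else phi.2.
Proof. by rewrite /pm_subst comp_mpolyXU; case: i => [[|[|]]]. Qed.

Lemma pm_substX0 phi : pm_subst phi 'X_0 = phi.1.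
Proof. by rewrite pm_substX. Qed.

Lemma pm_substX1 phi : pm_subst phi 'X_1 = phi.2.
Proof. by rewrite pm_substX. Qed.

Lemma pm_subst_id p : pm_subst (pm_id R) p = p.
Proof.
elim/mpoly_ringind: p => [c|i|p q IHp IHq|p q IHp IHq].
- exact: pm_substC.
- by rewrite pm_substX; case: i => [[|[|//]] ?]; congr 'X_(_); apply/val_inj.
- by rewrite rmorphD /= IHp IHq.
- by rewrite rmorphM /= IHp IHq.
Qed.

Lemma pm_subst_comp phi psi p :
  pm_subst (pm_comp phi psi) p = pm_subst psi (pm_subst phi p).
Proof.
elim/mpoly_ringind: p => [c|i|p q IHp IHq|p q IHp IHq].
- by rewrite !pm_substC.
- by rewrite !pm_substX; case: (i == 0).
- by rewrite !rmorphD /= IHp IHq.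
- by rewrite !rmorphM /= IHp IHq.
Qed.

Lemma pm_compA phi psi rho :
  pm_comp phi (pm_comp psi rho) = pm_comp (pm_comp phi psi) rho.
Proof. by rewrite [LHS]pm_compE !pm_subst_comp. Qed.

Lemma pm_comp1m phi : pm_comp (pm_id R) phi = phi.
Proof. by rewrite pm_compE pm_substX0 pm_substX1; case: phi. Qed.

Lemma pm_compm1 phi : pm_comp phi (pm_id R) = phi.
Proof. by rewrite pm_compE !pm_subst_id; case: phi. Qed.

Lemma pm_inverse_uniq phi psi rho :
  pm_inverse phi psi -> pm_comp phi rho = pm_id R -> psi = rho.
Proof.
by move=> [_ psiK] rhoK; rewrite -[LHS]pm_compm1 -rhoK pm_compA psiK pm_comp1m.
Qed.

(** Multiplication rule of a semidirect product, with [rho] the conjugate of [psi1]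
by [phi2]. *)
Lemma pm_comp_exchange phi1 phi2 psi1 psi2 rho :
  pm_comp psi1 phi2 = pm_comp phi2 rho ->
  pm_comp (pm_comp phi1 psi1) (pm_comp phi2 psi2) =
  pm_comp (pm_comp phi1 phi2) (pm_comp rho psi2).
Proof.
by move=> swap; rewrite -pm_compA [pm_comp psi1 _]pm_compA swap !pm_compA.
Qed.

Lemma pm_compKK phi psi phi' psi' :
  pm_comp phi phi' = pm_id R -> pm_comp psi psi' = pm_id R ->
  pm_comp (pm_comp phi psi) (pm_comp psi' phi') = pm_id R.
Proof.
by move=> phiK psiK; rewrite -pm_compA [pm_comp psi _]pm_compA psiK pm_comp1m.
Qed.

Lemma GA2_subgroup_GA2 : GA2_subgroup (@GA2 R).
Proof.
split=> //.
- by exists (pm_id R); split; apply: pm_comp1m.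
- move=> phi psi [phi' [phiK phi'K]] [psi' [psiK psi'K]].
  by exists (pm_comp psi' phi'); split; apply: pm_compKK.
- by move=> phi psi _ [? ?]; exists phi.
Qed.

(** Chain rule. *)
Lemma mderiv_subst phi p i :
  (pm_subst phi p)^`M(i) =
  pm_subst phi p^`M(0) * phi.1^`M(i) + pm_subst phi p^`M(1) * phi.2^`M(i).
Proof.
elim/mpoly_ringind: p => [c|j|p q IHp IHq|p q IHp IHq].
- by rewrite pm_substC !mderivC rmorph0 !mul0r addr0.
- rewrite !mderivXU pm_substX !rmorph_nat.
  by case: j => [[|[|//]] ?] /=; rewrite !(mul0r, mul1r, addr0, add0r).
- by rewrite !(rmorphD, mderivD) IHp IHq /=; ring.
- by rewrite !(rmorphM, mderivM, rmorphD) /= IHp IHq; ring.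
Qed.

Definition jacobian phi : {mpoly R[2]} :=
  (phi.1^`M(0) : {mpoly R[2]}) * phi.2^`M(1)
    - (phi.1^`M(1) : {mpoly R[2]}) * phi.2^`M(0).

Lemma jacobian_comp phi psi :
  jacobian (pm_comp phi psi) = pm_subst psi (jacobian phi) * jacobian psi.
Proof.
by rewrite /jacobian pm_compE !mderiv_subst rmorphB !rmorphM /=; ring.
Qed.

End Substitution.

(** * The elementary group *)

Section ElementaryGroup.
Variable R : comNzRingType.
Implicit Types (phi psi : polymap R) (f g : {poly R}).

Lemma subst_varE f i k : (size f <= k)%N ->
  subst_var f i = \sum_(j < k) (f`_j)%:MP * 'X_i ^+ j.
Proof.
move=> le_fk; rewrite /subst_var (horner_coef_wide _ (n := k)) => [|//].
  by apply: eq_bigr => j _; rewrite coef_map.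
by apply: leq_trans le_fk; apply: size_poly.
Qed.

Lemma subst_varN f i : subst_var (- f) i = - subst_var f i.
Proof. by rewrite /subst_var rmorphN hornerN. Qed.

Lemma pm_subst_var phi f i : pm_subst phi 'X_i = 'X_i ->
  pm_subst phi (subst_var f i) = subst_var f i.
Proof.
move=> phiXi; rewrite (subst_varE _ (leqnn _)) rmorph_sum.
by apply: eq_bigr => j _; rewrite rmorphM rmorphXn /= pm_substC phiXi.
Qed.

Lemma mderiv_subst_var f i j : i != j -> (subst_var f i)^`M(j) = 0.
Proof.
move=> nij; rewrite (subst_varE _ (leqnn _)) raddf_sum big1 // => k _ /=.
by rewrite mderiv_mulC mderiv_exp mderivXU (negPf nij) mulr0 mul0rn mulr0.
Qed.

Lemma elementary_GA2 phi : elementary phi -> GA2 phi.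
Proof.
have shear0 f : pm_comp ('X_0 + subst_var f 1, 'X_1)
    ('X_0 + subst_var (- f) 1, 'X_1) = pm_id R.
  rewrite pm_compE rmorphD /= pm_substX0 pm_subst_var ?pm_substX1 //=.
  by rewrite subst_varN addrNK.
have shear1 f : pm_comp ('X_0, 'X_1 + subst_var f 0)
    ('X_0, 'X_1 + subst_var (- f) 0) = pm_id R.
  rewrite pm_compE rmorphD /= pm_substX1 pm_subst_var ?pm_substX0 //=.
  by rewrite subst_varN addrNK.
move=> [f [->|->]].
  exists ('X_0 + subst_var (- f) 1, 'X_1); split => //.
  by rewrite -{2}[f]opprK.
exists ('X_0, 'X_1 + subst_var (- f) 0); split => //.
by rewrite -{2}[f]opprK.
Qed.

Lemma elementary_EA2 phi : elementary phi -> EA2 phi.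
Proof. by move=> el_phi S _; apply. Qed.

(** [EA2] is an intersection of subgroups; it lies in [GA2] because [GA2] is one
of the subgroups being intersected. *)
Lemma EA2_subgroup_EA2 : GA2_subgroup (@EA2 R).
Proof.
split=> [phi|S [_ S1 _ _] _ //|phi psi EAphi EApsi S gS elS|
         phi psi EAphi inv S gS elS].
- by apply; [apply: GA2_subgroup_GA2 | apply: elementary_GA2].
- by case: (gS) => _ _ SM _; apply: SM; [apply: EAphi | apply: EApsi].
- by case: (gS) => _ _ _ SV; apply: SV inv; apply: EAphi.
Qed.

Lemma jacobian_id : jacobian (pm_id R) = 1.
Proof. by rewrite /jacobian !mderivXU mulr1 mul0r subr0. Qed.

(** The automorphisms with Jacobian determinant 1 form a subgroup by the chain
rule, and shears belong to it. *)
Lemma jacobian_EA2 phi : EA2 phi -> jacobian phi = 1.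
Proof.
move=> /(_ (fun psi => GA2 psi /\ jacobian psi = 1)) [] //; last first.
  move=> psi el_psi; split; first exact: elementary_GA2.
  case: el_psi => f [->|->]; rewrite /jacobian /= !mderivD !mderivXU.
    rewrite (mderiv_subst_var f (isT : 1 != 0 :> 'I_2)).
    by rewrite addr0 mulr1 mulr0 subr0.
  rewrite (mderiv_subst_var f (isT : 0 != 1 :> 'I_2)).
  by rewrite addr0 mulr1 mul0r subr0.
have [_ G1 GM GV] := GA2_subgroup_GA2 R.
split=> [psi [] //|||].
- by split; [|apply: jacobian_id].
- move=> psi rho [Gpsi Jpsi] [Grho Jrho]; split; first exact: GM.
  by rewrite jacobian_comp Jpsi rmorph1 mul1r.
- move=> psi rho [Gpsi Jpsi] inv; split; first exact: GV inv.
  by rewrite -jacobian_id -(proj1 inv) jacobian_comp Jpsi rmorph1 mul1r.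
Qed.

End ElementaryGroup.

(** * Change of coefficient ring *)

Section BaseChange.
Variables (A R : comNzRingType) (h : {rmorphism A -> R}).

Lemma map_mpolyXU i : map_mpoly h ('X_i : {mpoly A[2]}) = 'X_i.
Proof. by rewrite map_mpolyX. Qed.

Lemma map_mpoly_subst phi p :
  map_mpoly h (pm_subst phi p) = pm_subst (pm_map h phi) (map_mpoly h p).
Proof.
elim/mpoly_ringind: p => [c|i|p q IHp IHq|p q IHp IHq].
- by rewrite pm_substC !map_mpolyC pm_substC.
- by rewrite map_mpolyXU !pm_substX; case: ifP.
- by rewrite !rmorphD /= IHp IHq.
- by rewrite !rmorphM /= IHp IHq.
Qed.

Lemma pm_map_comp phi psi :
  pm_map h (pm_comp phi psi) = pm_comp (pm_map h phi) (pm_map h psi).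
Proof. by rewrite !pm_compE /pm_map !map_mpoly_subst. Qed.

Lemma pm_map_id : pm_map h (pm_id A) = pm_id R.
Proof. by rewrite /pm_map !map_mpolyXU. Qed.

Lemma map_mpoly_mderiv n (p : {mpoly A[n]}) i :
  map_mpoly h p^`M(i) = (map_mpoly h p)^`M(i).
Proof.
apply/mpolyP => m.
by rewrite mcoeff_map_mpoly !mcoeff_mderiv raddfMn mcoeff_map_mpoly.
Qed.

End BaseChange.

(** * Infinitesimal maps over a ring with an element of square zero *)

Section FirstOrder.
Variables (A R : comNzRingType) (h : {rmorphism A -> R}) (t : R).
Hypothesis tt0 : t * t = 0.
Implicit Types (U V p : {mpoly A[2]}) (phi : polymap A).

(** For [U = H_X] and [V = H_Y] this is the infinitesimal Hamiltonian flow of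
[H]. *)
Definition infinitesimal U V : polymap R :=
  ('X_0 + t *: map_mpoly h V, 'X_1 - t *: map_mpoly h U).

(** Taylor expansion, exact at order one because [t * t = 0].  For [U = H_X] and
[V = H_Y] the correction term is the Poisson bracket of [p] with [H]. *)
Lemma infinitesimal_subst U V p :
  pm_subst (infinitesimal U V) (map_mpoly h p) =
  map_mpoly h p
    + t *: map_mpoly h ((p^`M(0) : {mpoly A[2]}) * V
                        - (p^`M(1) : {mpoly A[2]}) * U).
Proof.
have tt0P : (t%:MP * t%:MP = 0 :> {mpoly R[2]}) by rewrite -mpolyCM tt0 mpolyC0.
rewrite -!mul_mpolyC.
elim/mpoly_ringind: p => [c|i|p q IHp IHq|p q IHp IHq].
- by rewrite map_mpolyC pm_substC !mderivC !mul0r subr0 rmorph0 mulr0 addr0.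
- rewrite map_mpolyXU pm_substX !mderivXU /infinitesimal -!mul_mpolyC.
  case: i => [[|[|//]] ?] /=; rewrite !(mul0r, mul1r) (subr0, sub0r).
    by congr ('X_(_) + _); apply/val_inj.
  by rewrite rmorphN mulrN; congr ('X_(_) - _); apply/val_inj.
- by rewrite !rmorphD /= IHp IHq !mderivD !(rmorphB, rmorphD, rmorphM) /=; ring.
- rewrite !rmorphM /= IHp IHq !mderivM !(rmorphB, rmorphD, rmorphM) /=.
  ring: tt0P.
Qed.

(** The second flow displaces the first field only by a multiple of [t], which is
then multiplied by [t] again. *)
Lemma infinitesimal_comp U V U' V' :
  pm_comp (infinitesimal U V) (infinitesimal U' V') =
  infinitesimal (U + U') (V + V').
Proof.
have fixt p : pm_subst (infinitesimal U' V') (t *: map_mpoly h p) =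
    t *: map_mpoly h p.
  by rewrite pm_substZ infinitesimal_subst scalerDr scalerA tt0 scale0r addr0.
rewrite pm_compE rmorphD rmorphB /= pm_substX0 pm_substX1 !fixt.
rewrite /infinitesimal /=.
by rewrite !rmorphD /= !scalerDr; congr (_, _); ring.
Qed.

Lemma infinitesimal0 : infinitesimal 0 0 = pm_id R.
Proof. by rewrite /infinitesimal rmorph0 scaler0 addr0 subr0. Qed.

(** The new field comes from the pullback by [phi] of the differential form
[U dX + V dY]; for [U = H_X] and [V = H_Y] this is the differential of
[H o phi].  After the Taylor expansion the displacement of each coordinate is
the old one multiplied by the Jacobian determinant. *)
Lemma infinitesimal_conj U V phi : jacobian phi = 1 ->
  pm_comp (infinitesimal U V) (pm_map h phi) =
  pm_comp (pm_map h phi)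
    (infinitesimal
       (pm_subst phi U * phi.1^`M(0) + pm_subst phi V * phi.2^`M(0))
       (pm_subst phi U * phi.1^`M(1) + pm_subst phi V * phi.2^`M(1))).
Proof.
(* [ring] needs the hypothesis in the form monomial = polynomial. *)
rewrite /jacobian => /(canRL (subrK _)) J1.
rewrite !pm_compE /= !infinitesimal_subst rmorphD rmorphB /=.
rewrite pm_substX0 pm_substX1 !pm_substZ -!map_mpoly_subst /=.
congr (_ + _ *: map_mpoly h _, _).
  by ring: J1.
by rewrite -scalerN -rmorphN; congr (_ + _ *: map_mpoly h _); ring: J1.
Qed.

End FirstOrder.

(** * Hamiltonians that are sums of powers of coordinates *)

Section Hamiltonians.
Variables (A : comNzRingType) (Q : comAlgType rat) (iota : {rmorphism A -> Q}).
Implicit Types (a : A) (f U V : {mpoly A[2]}) (H : {mpoly Q[2]}).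

Definition scaled_power a m f : {mpoly Q[2]} :=
  (((m%:R)^-1 : rat) *: iota a) *: map_mpoly iota f ^+ m.

(** Adding one term at a time makes the closure properties short inductions; the
indexed sum is recovered in [coordinate_power_sumP]. *)
Inductive coordinate_power_sum : {mpoly Q[2]} -> Prop :=
| CoordinatePowerSum0 : coordinate_power_sum 0
| CoordinatePowerSumS a m f H of (0 < m)%N & EA2_coordinate f
    & coordinate_power_sum H : coordinate_power_sum (scaled_power a m f + H).

Lemma coordinate_power_sum1 a m f : (0 < m)%N -> EA2_coordinate f ->
  coordinate_power_sum (scaled_power a m f).
Proof.
by move=> m_gt0 Cf; rewrite -[scaled_power _ _ _]addr0; do !constructor.
Qed.

Lemma coordinate_power_sumD H H' :
  coordinate_power_sum H -> coordinate_power_sum H' ->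
  coordinate_power_sum (H + H').
Proof.
move=> PH PH'; elim: PH => [|a m f {}H m0 Cf _ IH]; first by rewrite add0r.
by rewrite -addrA; constructor.
Qed.

(** The sign is absorbed by the coefficient of each term. *)
Lemma coordinate_power_sumN H :
  coordinate_power_sum H -> coordinate_power_sum (- H).
Proof.
elim=> [|a m f {}H m0 Cf _ IH]; first by rewrite oppr0; constructor.
rewrite opprD; have -> : - scaled_power a m f = scaled_power (- a) m f.
  by rewrite /scaled_power rmorphN scalerN scaleNr.
by constructor.
Qed.

Lemma EA2_coordinate_subst phi f :
  EA2 phi -> EA2_coordinate f -> EA2_coordinate (pm_subst phi f).
Proof.
have [_ _ EM _] := EA2_subgroup_EA2 A.
move=> Ephi [psi [Epsi fE]]; exists (pm_comp psi phi); split; first exact: EM.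
by rewrite pm_compE; case: fE => ->; [left | right].
Qed.

Lemma coordinate_power_sum_subst phi H : EA2 phi ->
  coordinate_power_sum H -> coordinate_power_sum (pm_subst (pm_map iota phi) H).
Proof.
move=> Ephi; elim=> [|a m f {}H m0 Cf _ IH].
  by rewrite rmorph0; constructor.
rewrite rmorphD /= /scaled_power pm_substZ rmorphXn /= -map_mpoly_subst.
by constructor => //; apply: EA2_coordinate_subst.
Qed.

Lemma coordinate_power_sumP H : coordinate_power_sum H ->
  exists (r : nat) (a : 'I_r -> A) (m : 'I_r -> nat) (f : 'I_r -> {mpoly A[2]}),
    [/\ forall i, (0 < m i)%N, forall i, EA2_coordinate (f i)
      & H = \sum_(i < r) scaled_power (a i) (m i) (f i)].
Proof.
elim=> [|a0 m0 f0 {}H m0_gt0 Cf0 _ [r [a [m [f [m_gt0 Cf ->]]]]]].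
  exists 0%N, (fun=> 0), (fun=> 1%N), (fun=> 0).
  by split=> [[]|[]|] //; rewrite big_ord0.
pose cons T (x : T) (s : 'I_r -> T) (i : 'I_r.+1) : T :=
  if unlift ord0 i is Some j then s j else x.
exists r.+1, (cons A a0 a), (cons nat m0 m), (cons {mpoly A[2]} f0 f); split.
- by move=> i; rewrite /cons; case: unliftP.
- by move=> i; rewrite /cons; case: unliftP.
- rewrite big_ord_recl /cons unlift_none; congr (_ + _).
  by apply: eq_bigr => i _; rewrite liftK.
Qed.

(** [H] may have denominators, but its differential [U dX + V dY] is defined over
[A]. *)
Definition hamiltonian U V H : Prop :=
  [/\ coordinate_power_sum H, H^`M(0) = map_mpoly iota U
    & H^`M(1) = map_mpoly iota V].

Lemma hamiltonianD U V H U' V' H' : hamiltonian U V H ->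
  hamiltonian U' V' H' -> hamiltonian (U + U') (V + V') (H + H').
Proof.
move=> [PH H0 H1] [PH' H0' H1']; split; first exact: coordinate_power_sumD.
- by rewrite mderivD H0 H0' rmorphD.
- by rewrite mderivD H1 H1' rmorphD.
Qed.

Lemma hamiltonianN U V H : hamiltonian U V H -> hamiltonian (- U) (- V) (- H).
Proof.
move=> [PH H0 H1]; split; first exact: coordinate_power_sumN.
- by rewrite mderivN H0 rmorphN.
- by rewrite mderivN H1 rmorphN.
Qed.

(** By the chain rule, the partial derivatives of [H o phi] are exactly the field
produced by [infinitesimal_conj]. *)
Lemma hamiltonian_subst phi U V H : EA2 phi -> hamiltonian U V H ->
  hamiltonian
    (pm_subst phi U * phi.1^`M(0) + pm_subst phi V * phi.2^`M(0))
    (pm_subst phi U * phi.1^`M(1) + pm_subst phi V * phi.2^`M(1))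
    (pm_subst (pm_map iota phi) H).
Proof.
move=> Ephi [PH H0 H1]; split; first exact: coordinate_power_sum_subst.
- rewrite mderiv_subst H0 H1 rmorphD !rmorphM /=.
  by rewrite !map_mpoly_subst !map_mpoly_mderiv.
- rewrite mderiv_subst H0 H1 rmorphD !rmorphM /=.
  by rewrite !map_mpoly_subst !map_mpoly_mderiv.
Qed.

Lemma EA2_coordinateX i : EA2_coordinate ('X_i : {mpoly A[2]}).
Proof.
have [_ E1 _ _] := EA2_subgroup_EA2 A.
exists (pm_id A); split=> //; case: i => [[|[|//]] ?]; [left | right];
by congr 'X_(_); apply/val_inj.
Qed.

(** This is where rational coefficients are needed: the primitive of [c * X ^ k]
is [c / (k + 1) * X ^ (k + 1)]. *)
Lemma primitive_subst_var (g : {poly A}) i : exists H,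
  [/\ coordinate_power_sum H, H^`M(i) = map_mpoly iota (subst_var g i)
    & forall j, i != j -> H^`M(j) = 0].
Proof.
exists (\sum_(k < size g) scaled_power g`_k k.+1 'X_i); split.
- elim/big_ind: _ => [||k _]; [by constructor | exact: coordinate_power_sumD |].
  by apply: coordinate_power_sum1 => //; apply: EA2_coordinateX.
- rewrite (subst_varE _ (leqnn _)) !raddf_sum; apply: eq_bigr => k _ /=.
  rewrite mderivZ mderiv_exp map_mpolyXU mderivXU eqxx mulr1 /=.
  rewrite rmorphM rmorphXn /= map_mpolyC map_mpolyXU mul_mpolyC.
  rewrite -scalerMnr scalerMnl -scaler_nat scalerA divff ?scale1r //.
  by rewrite Num.Theory.pnatr_eq0.
- move=> j nij; rewrite raddf_sum big1 // => k _ /=.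
  rewrite mderivZ mderiv_exp map_mpolyXU mderivXU (negPf nij).
  by rewrite mulr0 mul0rn scaler0.
Qed.

End Hamiltonians.

(** * Decomposition of elementary automorphisms *)

Section Decomposition.
Variables (A : comNzRingType) (Q : comAlgType rat) (iota : {rmorphism A -> Q}).
Variables (R : comNzRingType) (h : {rmorphism A -> R}) (t : R).
Variables (re im : R -> A).
Hypothesis tt0 : t * t = 0.
Hypothesis re_im : forall x, x = h (re x) + t * h (im x).
Implicit Types (phi psi : polymap R).

Definition hamiltonian_decomposition phi : Prop :=
  exists (phi0 : polymap A) U V H, [/\ EA2 phi0, hamiltonian iota U V H
    & phi = pm_comp (pm_map h phi0) (infinitesimal h t U V)].

Lemma subst_var_split (f : {poly R}) i : exists g0 g1 : {poly A},
  subst_var f i =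
  map_mpoly h (subst_var g0 i) + t *: map_mpoly h (subst_var g1 i).
Proof.
pose g (c : R -> A) := \poly_(k < size f) c f`_k.
have gE c : subst_var (g c) i = \sum_(k < size f) (c f`_k)%:MP * 'X_i ^+ k.
  rewrite (subst_varE _ (size_poly _ _)); apply: eq_bigr => k _.
  by rewrite coef_poly ltn_ord.
exists (g re), (g im); rewrite !gE (subst_varE _ (leqnn _)) !rmorph_sum.
rewrite scaler_sumr -big_split; apply: eq_bigr => k _ /=.
rewrite !rmorphM !rmorphXn /= !map_mpolyC map_mpolyXU scalerAl -mulrDl.
by congr (_ * _); rewrite -mul_mpolyC -mpolyCM -mpolyCD -re_im.
Qed.

(** The part of the shear along [t] is integrated in the variable it depends on.
When that variable is [X], the polynomial to integrate is [- g1], as [H_X]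
enters the flow with a minus sign. *)
Lemma elementary_decomposition phi :
  elementary phi -> hamiltonian_decomposition phi.
Proof.
move=> [f [->|->]].
- have [g0 [g1 ->]] := subst_var_split f 1.
  have [H [PH H1 H0]] := primitive_subst_var iota g1 1.
  exists ('X_0 + subst_var g0 1, 'X_1), 0, (subst_var g1 1), H; split.
  + by apply: elementary_EA2; exists g0; left.
  + by split=> //; rewrite H0 ?rmorph0.
  rewrite pm_compE /= rmorphD rmorphD /= !map_mpolyXU pm_substX0 pm_substX1.
  rewrite (infinitesimal_subst _ tt0).
  rewrite (mderiv_subst_var g0 (isT : 1 != 0 :> 'I_2)) /=.
  rewrite mul0r mulr0 subr0 rmorph0 !scaler0 !addr0 subr0.
  by rewrite -addrA [_ + t *: _]addrC.
- have [g0 [g1 ->]] := subst_var_split f 0.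
  have [H [PH H0 H1]] := primitive_subst_var iota (- g1) 0.
  exists ('X_0, 'X_1 + subst_var g0 0), (subst_var (- g1) 0), 0, H; split.
  + by apply: elementary_EA2; exists g0; right.
  + by split=> //; rewrite H1 ?rmorph0.
  rewrite pm_compE /= rmorphD rmorphD /= !map_mpolyXU pm_substX0 pm_substX1.
  rewrite (infinitesimal_subst _ tt0).
  rewrite (mderiv_subst_var g0 (isT : 0 != 1 :> 'I_2)) /=.
  rewrite mul0r mulr0 subr0 rmorph0 !scaler0 !addr0.
  by rewrite subst_varN rmorphN scalerN opprK -addrA [_ + t *: _]addrC.
Qed.

(** For a product, [(a o e(H)) o (b o e(K)) = (a o b) o e(H o b + K)]; for an
inverse, [e(-H) o b = b o e(- H o b)] where [b] is the inverse of [a]. *)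
Lemma decomposition_subgroup :
  GA2_subgroup (fun phi => EA2 phi /\ hamiltonian_decomposition phi).
Proof.
have [EG E1 EM EV] := EA2_subgroup_EA2 R.
have [EG0 E01 EM0 EV0] := EA2_subgroup_EA2 A.
split.
- by move=> phi [/EG].
- split=> //; exists (pm_id A), 0, 0, 0; split=> //.
    by split; rewrite ?mderiv0 ?rmorph0 //; constructor.
  by rewrite pm_map_id infinitesimal0 pm_comp1m.
- move=> phi psi [Ephi [phi0 [U [V [H [Ephi0 HH phiE]]]]]].
  move=> [Epsi [psi0 [U' [V' [H' [Epsi0 HH' psiE]]]]]].
  split; first exact: EM.
  have HHpsi := hamiltonian_subst Epsi0 HH.
  exists (pm_comp phi0 psi0); do 3!eexists; split.
  + exact: EM0.
  + exact: hamiltonianD HHpsi HH'.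
  rewrite -(infinitesimal_comp _ tt0) pm_map_comp phiE psiE.
  apply: pm_comp_exchange.
  exact: (infinitesimal_conj _ tt0 _ _ (jacobian_EA2 Epsi0)).
- move=> phi psi [Ephi [phi0 [U [V [H [Ephi0 HH phiE]]]]]] inv.
  split; first exact: EV inv.
  have [psi0 inv0] := EG0 _ Ephi0.
  have Epsi0 := EV0 _ _ Ephi0 inv0.
  exists psi0; do 3!eexists; split.
  + exact: Epsi0.
  + exact: hamiltonian_subst Epsi0 (hamiltonianN HH).
  apply: pm_inverse_uniq inv _.
  rewrite -(infinitesimal_conj _ tt0 _ _ (jacobian_EA2 Epsi0)) phiE.
  apply: pm_compKK.
    by rewrite -pm_map_comp (proj1 inv0) pm_map_id.
  by rewrite (infinitesimal_comp _ tt0) !subrr infinitesimal0.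
Qed.

Lemma EA2_hamiltonian_decomposition phi :
  EA2 phi -> hamiltonian_decomposition phi.
Proof.
move=> /(_ _ decomposition_subgroup)[] // psi el_psi; split.
  exact: elementary_EA2.
exact: elementary_decomposition.
Qed.

End Decomposition.

(** * Dual numbers *)

Section DualNumbers.
Variable A : comNzRingType.

Lemma dual_t_sqr : dual_t A * dual_t A = 0.
Proof.
rewrite /dual_t /qpolyX -in_qpolyM -expr2; apply: val_inj => /=.
by rewrite mk_monic_Xn Pdiv.RingMonic.rmodpp ?monicXn.
Qed.

Lemma dual_split (x : dual A) :
  x = dualC (x : {poly A})`_0 + dual_t A * dualC (x : {poly A})`_1.
Proof.
have size_x : (size (x : {poly A}) <= 2)%N.
  have size_mod : size (mk_monic ('X^2 : {poly A})) = 3%N.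
    by rewrite mk_monic_Xn size_polyXn.
  by rewrite -ltnS -size_mod size_mk_monic.
have dualCE (c : A) : dualC c = in_qpoly 'X^2 c%:P.
  apply: val_inj; rewrite [RHS]in_qpoly_small //.
  by rewrite mk_monic_Xn size_polyXn (leq_ltn_trans (size_polyC_leq1 c)).
rewrite !dualCE /dual_t /qpolyX -in_qpolyM -in_qpolyD.
have <- : (x : {poly A}) = ((x : {poly A})`_0)%:P + 'X * ((x : {poly A})`_1)%:P.
  apply/polyP => -[|[|k]]; rewrite coefD coefC coefXM ?coefC ?addr0 ?add0r //=.
  by rewrite nth_default // (leq_trans size_x).
by apply: val_inj; rewrite [RHS]in_qpoly_small // size_mk_monic.
Qed.

End DualNumbers.

Theorem theorem4p6 (A : comNzRingType) (Q : comAlgType rat)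
    (iota : {rmorphism A -> Q}) (iota_inj : injective iota)
    (phi1 : polymap (dual A)) (phi1_EA2 : EA2 phi1) :
  exists (phi0 : polymap A) (H : {mpoly Q[2]}) (HX HY : {mpoly A[2]}),
    [/\ EA2 phi0,
        H^`M(0) = map_mpoly iota HX,
        H^`M(1) = map_mpoly iota HY,
        phi1 = pm_comp (pm_map (@dualC A) phi0)
                 ('X_0 + dual_t A *: map_mpoly (@dualC A) HY,
                  'X_1 - dual_t A *: map_mpoly (@dualC A) HX)
      & exists (r : nat) (a : 'I_r -> A) (m : 'I_r -> nat)
               (f : 'I_r -> {mpoly A[2]}),
          [/\ forall i, (0 < m i)%N,
              forall i, EA2_coordinate (f i)
            & H = \sum_(i < r)
                    (((m i)%:R^-1 : rat) *: iota (a i))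
                      *: map_mpoly iota (f i) ^+ m i]].
Proof.
have [phi0 [HX [HY [H [Ephi0 [/coordinate_power_sumP PH H0 H1] phi1E]]]]] :=
  EA2_hamiltonian_decomposition iota (@dual_t_sqr A) (@dual_split A) phi1_EA2.
by exists phi0, H, HX, HY.
Qed.
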